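(* Let $c=\sum_{k\geq 0} k!\,x_1^k\in\mathbb{R}\langle\langle X\rangle\rangle$ and, for $n\ge 1$, define the polynomials $$a_n:=\big((-c)^{\circ -1}\big)_n=\sum_{\eta\in X^*_n} Sa_\eta(-c)\,\eta .$$ Let $\alpha,\beta$ be real analytic functions on an interval containing $0$, put $u=\{u_0,u_1\}=\{\alpha,\beta\}$, and let $\sum_{n\ge 1}a_n(t)r^n$ be the formal solution of the Abel equation $\dot z(t)=\alpha(t)z^3(t)+\beta(t)z^2(t)$ with $z(0)=r$. Then for every $n\ge 1$ the functions $a_n(t)$ and the polynomials $a_n$ are related by $$a_n(t)=F_{a_n}[u](t).$$
   Context: Words and series. $X=\{x_0,x_1\}$ is an alphabet of two noncommuting letters, $X^*$ the set of all words over $X$ including the empty word $\emptyset$, and $\mathbb{R}\langle\langle X\rangle\rangle$ the set of formal series $c=\sum_{\eta\in X^*}\langle c,\eta\rangle\eta$ with real coefficients; $\mathbf 1=1\emptyset$. For $\eta\in X^*$, $|\eta|_{x_i}$ is the number of occurrences of $x_i$ in $\eta$, and $\deg(\eta)=2|\eta|_{x_0}+|\eta|_{x_1}+1$. $X^*_n$ is the (finite) set of words of degree $n$, and $(c)_n:=\sum_{\eta\in X^*_n}\langle c,\eta\rangle\eta$. Shuffle product. $\sqcup\!\sqcup$ is the bilinear product determined by $\emptyset\sqcup\!\sqcup\,\eta=\eta\sqcup\!\sqcup\,\emptyset=\eta$ and $x_i\eta\sqcup\!\sqcup\, x_j\nu=x_i(\eta\sqcup\!\sqcup\, x_j\nu)+x_j(x_i\eta\sqcup\!\sqcup\,\nu)$,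 extended to series. Feedback group. For $c,d\in\mathbb{R}\langle\langle X\rangle\rangle$ the modified composition product is $c\,\tilde\circ\,d=\sum_{\eta\in X^*}\langle c,\eta\rangle\,\phi_d(\eta)(\mathbf 1)$, where $\phi_d(\emptyset)=id$, $\phi_d(x_{i_1}\cdots x_{i_k})=\phi_d(x_{i_1})\circ\cdots\circ\phi_d(x_{i_k})$, $\phi_d(x_0)(e)=x_0e$, $\phi_d(x_1)(e)=x_1e+x_0(d\sqcup\!\sqcup\, e)$ for $e\in\mathbb{R}\langle\langle X\rangle\rangle$. With a formal symbol $\delta$ and $c_\delta:=\delta+c$, the set of all $c_\delta$ is a group with unit $\delta$ under $c_\delta\circ d_\delta:=\delta+d+c\,\tilde\circ\,d$. The series $c^{\circ-1}$ is defined by $c_\delta^{\circ-1}=\delta+c^{\circ-1}$. Output feedback Hopf algebra. $H$ is the free unital commutative $\mathbb{R}$-algebra (unit $\mathbf 1$) on generators $a_\eta$, $\eta\in X^*$ (coordinate functions). An element of $H$ is evaluated at a series $c$ by the unital algebra morphism with $a_\eta(c)=\langle c,\eta\rangle$. The counit satisfies $\varepsilon(a_\eta)=0$, and the coproduct $\Delta$ is the algebra morphism with $\Delta a_\eta=\tilde\Delta a_\eta+\mathbf 1\otimes a_\eta$, where $\tilde\Delta a_\eta=\sum a_{\eta(1)}\otimes a_{\eta(2)}\in H\otimes H$ is the element such that $\sum a_{\eta(1)}(c)\,a_{\eta(2)}(d)=\langle c\,\tilde\circ\,d,\eta\rangle$ for all series $c,d$. It is known that $H$ is a connected graded Hopf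 algebra with $\deg(a_\eta)=\deg(\eta)$; $S$ denotes its antipode, and $Sa_\eta(c)=\langle c^{\circ-1},\eta\rangle$ for every series $c$. Fliess operators. For functions $u_0,u_1$, iterated integrals are defined by $E_\emptyset[u](t)=1$ and $E_{x_i\eta}[u](t)=\int_0^t u_i(s)E_\eta[u](s)\,ds$; for a series $c$, $F_c[u](t)=\sum_{\eta\in X^*}\langle c,\eta\rangle E_\eta[u](t)$ (a finite sum when $c$ is a polynomial). Formal solution. The formal solution of the Abel equation with $z(0)=r$ is the power series $\sum_{n\ge1}a_n(t)r^n$, with $a_n(t)$ analytic, $a_1(0)=1$, $a_n(0)=0$ for $n>1$, satisfying the differential equation coefficientwise as a formal power series in $r$. Here $a_n(t)$ denotes a function and $a_n$ a noncommutative polynomial; these should not be confused with the coordinate functions $a_\eta$. *)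

(* Defs.v *)
From HB Require Import structures.
From Stdlib Require Import Reals ClassicalEpsilon.
From Coquelicot Require Import Coquelicot.
From mathcomp Require Import all_boot all_algebra.
From mathcomp Require Import finmap monalg.
From mathcomp Require Import Rstruct.

Set Implicit Arguments.
Unset Strict Implicit.
Unset Printing Implicit Defensive.

Import GRing.Theory.

(* The reals are Stdlib's [R], with the ring structure of Rstruct; all formulas
   are written in [ring_scope], and the analysis uses Coquelicot. *)
Local Open Scope ring_scope.

Definition letter := bool.
Definition x0 : letter := false.
Definition x1 : letter := true.

Definition word := seq letter.

Definition series := word -> R.

Definition ncpoly := {malg R[word]}.

Definition deg (eta : word) : nat :=
  (2 * count_mem x0 eta + count_mem x1 eta + 1)%N.

Definition words_le (N : nat) : seq word :=
  flatten [seq [seq tval w | w <- enum {: k.-tuple letter}] | k <- iota 0 N.+1].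

Lemma mem_words_le N (eta : word) : (eta \in words_le N) = (size eta <= N)%N.
Proof.
apply/flatten_mapP/idP => [[k] | le_eta].
  by rewrite mem_iota /= add0n ltnS => le_k /mapP[w _ ->]; rewrite size_tuple.
exists (size eta); first by rewrite mem_iota.
by apply/mapP; exists (in_tuple eta); rewrite ?mem_enum.
Qed.

Lemma uniq_words_le N : uniq (words_le N).
Proof.
elim: N => [|N IH].
  by rewrite /words_le /= cats0 map_inj_uniq ?enum_uniq //; apply: val_inj.
rewrite /words_le -(addn1 N.+1) iotaD map_cat flatten_cat cat_uniq.
rewrite -/(words_le N) IH /= add0n cats0.
rewrite map_inj_uniq ?enum_uniq ?andbT; last exact: val_inj.
apply/hasPn => eta /mapP[w _ ->].
by change (val w \notin words_le N); rewrite mem_words_le size_tuple ltnn.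
Qed.

Definition words_deg (n : nat) : seq word :=
  [seq eta <- words_le n | deg eta == n].

Lemma mem_words_deg n (eta : word) : (eta \in words_deg n) = (deg eta == n).
Proof.
rewrite mem_filter mem_words_le andb_idr // => /eqP <-.
rewrite /deg mul2n -addnn -(count_predC (pred1 x0) eta) -addnA.
have -> : count (predC (pred1 x0)) eta = count_mem x1 eta.
  by apply: eq_count => -[].
by rewrite -!addnA leq_add2l (leq_trans (leq_addr 1 _)) ?leq_addl.
Qed.

Lemma uniq_words_deg n : uniq (words_deg n).
Proof. exact/filter_uniq/uniq_words_le. Qed.

Definition hpart (n : nat) (c : series) : ncpoly :=
  \sum_(eta <- words_deg n) << c eta *g eta >>.

(* The series 1, i.e. the empty word. *)
Definition sone : series := fun nu => (nu == [::])%:R.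

(* The series [x e], obtained by prefixing every word of [e] with [x]. *)
Definition lcons (x : letter) (e : series) : series :=
  fun nu => if nu is y :: nu' then if y == x then e nu' else 0 else 0.

(* The words of the shuffle of [eta] and [xi], repeated according to their
   coefficients. *)
Fixpoint shuffle_word (eta : word) : word -> seq word :=
  fix shuffle_eta (xi : word) : seq word :=
    match eta, xi with
    | [::], _ => [:: xi]
    | _, [::] => [:: eta]
    | x :: eta', y :: xi' =>
        [seq x :: w | w <- shuffle_word eta' xi] ++
        [seq y :: w | w <- shuffle_eta xi']
    end.

Lemma size_shuffle_word (eta xi nu : word) :
  nu \in shuffle_word eta xi -> size nu = (size eta + size xi)%N.
Proof.
elim: eta xi nu => [|x eta IHeta]; first by case=> [|y xi] nu /=;
  rewrite inE => /eqP->.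
elim=> [|y xi IHxi] nu /=; first by rewrite inE => /eqP->; rewrite /= addn0.
rewrite mem_cat => /orP[] /mapP[w w_in ->] /=.
  by rewrite (IHeta _ _ w_in).
by rewrite (IHxi _ w_in) /= addnS.
Qed.

(* By [size_shuffle_word], only words no longer than [nu] contribute to the
   coefficient of [nu]. *)
Definition shuffle (c d : series) : series := fun nu =>
  \sum_(eta <- words_le (size nu)) \sum_(xi <- words_le (size nu))
    c eta * d xi * (count_mem nu (shuffle_word eta xi))%:R.

Definition phi_letter (d : series) (x : letter) (e : series) : series :=
  if x == x0 then lcons x0 e else lcons x1 e \+ lcons x0 (shuffle d e).

Definition phi (d : series) (eta : word) (e : series) : series :=
  foldr (phi_letter d) e eta.

Lemma phi_short (d : series) (eta nu : word) :
  (size nu < size eta)%N -> phi d eta sone nu = 0.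
Proof.
elim: eta nu => [|x eta IH] // [|y nu] /= lt_nu.
  by rewrite /phi /= /phi_letter; case: ifP => //= _; rewrite addr0.
have lt1 : (size nu < size eta)%N by [].
have sh0 : shuffle d (phi d eta sone) nu = 0.
  rewrite /shuffle big1_seq // => rho _; rewrite big1_seq // => xi /andP[_].
  rewrite mem_words_le => le_xi.
  by rewrite IH ?mulr0 ?mul0r // (leq_ltn_trans le_xi).
rewrite /= /phi_letter -/(phi d eta sone); case: ifP => _ /=.
  by case: ifP => // _; apply: IH.
by rewrite IH // sh0 !if_same addr0.
Qed.

(* The modified composition product [c ~o d].  By [phi_short], the words
   longer than [nu] do not contribute to the coefficient of [nu]. *)
Definition mcomp (c d : series) : series := fun nu =>
  \sum_(eta <- words_le (size nu)) c eta * phi d eta sone nu.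

Lemma mcomp_widen (c d : series) (nu : word) (N : nat) : (size nu <= N)%N ->
  mcomp c d nu = \sum_(eta <- words_le N) c eta * phi d eta sone nu.
Proof.
move=> le_N; rewrite [RHS](bigID (fun eta : word => (size eta <= size nu)%N)) /=.
rewrite [X in _ + X]big1 ?addr0 => [|eta]; last first.
  by rewrite -ltnNge => /phi_short->; rewrite mulr0.
rewrite -big_filter; apply/perm_big/uniq_perm.
- exact: uniq_words_le.
- exact/filter_uniq/uniq_words_le.
move=> eta; rewrite mem_filter !mem_words_le andb_idr // => le_eta.
exact: leq_trans le_eta le_N.
Qed.

(* The group element [delta + c] is represented by [c]; its unit [delta] is
   thus represented by the zero series. *)
Definition fgmul (c d : series) : series := d \+ mcomp c d.
Definition fgunit : series := fun _ => 0.

Definition is_fginv (c d : series) : Prop :=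
  fgmul c d =1 fgunit /\ fgmul d c =1 fgunit.

Definition fginv (c : series) : series :=
  epsilon (inhabits fgunit) (is_fginv c).

Notation mon := {cmonom word}.

Definition Halg := {malg R[mon]}.

Definition coordf (eta : word) : Halg := << ucm eta >>.

Definition mon_eval (c : series) (m : mon) : R :=
  \prod_(eta <- finsupp m) c eta ^+ m eta.

Definition heval (c : series) (h : Halg) : R := mmap idfun (mon_eval c) h.

Lemma heval_coordf (c : series) (eta : word) : heval c (coordf eta) = c eta.
Proof.
by rewrite /heval /coordf mmapU /= mul1r /mon_eval mdomU big_seq_fset1 cmUU.
Qed.

Section PairMonom.
Context (M1 M2 : conomType).
Implicit Types p q : M1 * M2.

Let pone : M1 * M2 := (mone, mone).
Let pmul p q : M1 * M2 := (mmul p.1 q.1, mmul p.2 q.2).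

Let pmulA : associative pmul.
Proof. by move=> p q r; rewrite /pmul /= !mulmA. Qed.
Let pmul1m : left_id pone pmul.
Proof. by case=> m n; rewrite /pmul /= !mul1m. Qed.
Let pmulm1 : right_id pone pmul.
Proof. by case=> m n; rewrite /pmul /= !mulm1. Qed.
Let punitm p q : pmul p q = pone -> p = pone /\ q = pone.
Proof. by case: p q => [m n] [k l] [/unitm[/= -> ->] /unitm[/= -> ->]]. Qed.
Let pmulC : commutative pmul.
Proof.
by move=> p q; rewrite /pmul (mulmC p.1) (mulmC p.2).
Qed.

HB.instance Definition _ := Choice_isMonomialDef.Build (M1 * M2)%type
  pmulA pmul1m pmulm1 punitm.
HB.instance Definition _ := MonomialDef_isConomialDef.Build (M1 * M2)%type
  pmulC.
End PairMonom.

(* The tensor product of [Halg] with itself: the algebra with basis the pairs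
   of monomials [m (x) m'] and the componentwise product. *)
Definition Halg2 := {malg R[(mon * mon)%type]}.

Definition tensor (h k : Halg) : Halg2 :=
  \sum_(m <- msupp h) \sum_(m' <- msupp k) << h@_m * k@_m' *g (m, m') >>.

(* [heval2 c d] maps [h (x) k] to [heval c h * heval d k]. *)
Definition heval2 (c d : series) (T : Halg2) : R :=
  mmap idfun (fun p : mon * mon => mon_eval c p.1 * mon_eval d p.2) T.

(* [conv f g] maps [h (x) k] to [f h * g k]. *)
Definition conv (f g : Halg -> Halg) (T : Halg2) : Halg :=
  \sum_(p <- msupp T) T@_p *: (f << p.1 >> * g << p.2 >>).

(* The unital algebra morphism sending every [coordf eta] to 0. *)
Definition counit (h : Halg) : R := heval (fun _ => 0) h.

Definition is_reduced_coproduct (Dred : word -> Halg2) : Prop :=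
  forall (eta : word) (c d : series), heval2 c d (Dred eta) = mcomp c d eta.

Definition is_coproduct (Delta : {lrmorphism Halg -> Halg2}) : Prop :=
  exists2 Dred : word -> Halg2, is_reduced_coproduct Dred &
    forall eta : word, Delta (coordf eta) = Dred eta + tensor 1 (coordf eta).

Definition is_antipode (Delta : {lrmorphism Halg -> Halg2})
    (S : {linear Halg -> Halg}) : Prop :=
  forall h : Halg, conv S idfun (Delta h) = counit h *: 1 /\
                conv idfun S (Delta h) = counit h *: 1.

Fixpoint iterint (u : letter -> R -> R) (eta : word) (t : R) : R :=
  if eta is x :: eta' then RInt (fun s => u x s * iterint u eta' s) 0 t
  else 1.

(* Only polynomials are considered, so that the defining sum is finite. *)
Definition fliess (p : ncpoly) (u : letter -> R -> R) (t : R) : R :=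
  \sum_(eta <- msupp p) p@_eta * iterint u eta t.

Definition input (alpha beta : R -> R) : letter -> R -> R :=
  fun x => if x == x0 then alpha else beta.

Definition is_interval (I : R -> Prop) : Prop :=
  forall x y z : R, I x -> I y -> (x <= z <= y) -> I z.

(* Relative to [I], so that [I] may contain its endpoints. *)
Definition analytic_on (I : R -> Prop) (f : R -> R) : Prop :=
  forall x : R, I x -> exists a : nat -> R,
    Rbar_lt (Rbar.Finite 0) (CV_radius a) /\
    within I (locally x) (fun y => f y = PSeries a (y - x)).

(* One-sided derivative at the endpoints of [I] belonging to [I]. *)
Definition is_derive_in (I : R -> Prop) (f : R -> R) (x l : R) : Prop :=
  filterdiff f (within I (locally x)) (fun h : R => (h * l)).

(* The coefficients of the power series in [r] whose constant term is zero. *)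
Definition zcoef (a : nat -> R -> R) (t : R) : nat -> R :=
  fun n => if n is 0%N then 0 else a n t.

Definition formal_solution (I : R -> Prop) (alpha beta : R -> R)
    (a : nat -> R -> R) : Prop :=
  [/\ forall n, (1 <= n)%N -> analytic_on I (a n),
      a 1%N 0 = 1,
      forall n, (1 < n)%N -> a n 0 = 0
    & forall n t, (1 <= n)%N -> I t ->
        let z := zcoef a t in
        is_derive_in I (a n) t
          (alpha t * PS_mult z (PS_mult z z) n + beta t * PS_mult z z n)].

Definition fact_series : series :=
  fun eta => if eta == nseq (size eta) x1 then (size eta)`!%:R else 0.

Definition abel_poly (n : nat) : ncpoly := hpart n (fginv (\- fact_series)).

(* Main.v *)
Require Import Defs.
From HB Require Import structures.
From Stdlib Require Import Reals ClassicalEpsilon FunctionalExtensionality Lra.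
From Coquelicot Require Import Coquelicot.
From mathcomp Require Import all_boot all_algebra.
From mathcomp Require Import finmap monalg.
From mathcomp Require Import Rstruct.

Set Implicit Arguments.
Unset Strict Implicit.
Unset Printing Implicit Defensive.

Import GRing.Theory.
Local Open Scope ring_scope.

(** Write products for shuffles, [c] for the series of factorials and [e] for
    the feedback inverse of [- c].

    In the shuffle algebra [c = 1 / (1 - x1)], because shuffling with a letter
    inserts it everywhere ([fact_series_geometric]); in other words
    [c = 1 + x1 c ^ 2], where [x1 c ^ 2] is [c ^ 2] with [x1] prefixed to its
    words. Modified composition with [d] is a morphism for the shuffle product
    ([mcomp_shuffle]) that replaces the letter [x1] with [x1 + x0 d]. That
    [- c] composed with [e] is the unit means that [e] is the composite of [c]
    with [e], hence [e = 1 + x1 e ^ 2 + x0 e ^ 3] ([fginv_abel_system]). This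
    equation determines a series, one length of words at a time, and its
    solution is conversely a two-sided inverse ([abel_system_fginv]).

    Sending a series to the power series in [r] whose coefficients are the
    Fliess operators of its homogeneous components takes the shuffle product,
    up to one power of [r], to the product ([fliess_gen_shuffle]), and takes
    removal of a first letter to the part of the time derivative along the
    matching input ([is_derive_fliess_gen]). The equation of [e] thus becomes
    the Abel equation [z' = beta z ^ 2 + alpha z ^ 3] with [z(0) = r]. The
    coefficient of order [n] of its right-hand side involves only lower orders
    of [z], so that the formal solution is unique ([formal_solution_fliess]).

    The antipode evaluates at [- c] to the coefficients of [e] because the
    convolution of the evaluation at [- c] with the evaluation at [e], and with
    the composite of the antipode and the evaluation at [- c], is the counit
    in both cases. The coproduct of a monomial [m] is [1 (x) m] plus terms with
    right factors of lower weight ([coproduct_triangular]), so the left factor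
    can be cancelled by induction on the weight ([convolution_cancel],
    [antipode_eval]). The coproduct is only known through its values; its terms
    are recovered from them by the linear independence of distinct monomials
    ([heval2_inj]). *)

(** * The shuffle algebra *)

(** Removing a first letter [x]: on Fliess operators, the part of the
    derivative that multiplies the input [u x]. *)
Definition lderiv (x : letter) (c : series) : series := fun nu => c (x :: nu).

(** The first letter of a word of the shuffle is the first letter of one of
    the two factors. *)
Lemma count_shuffle_cons (eta xi : word) (x : letter) (nu : word) :
  count_mem (x :: nu) (shuffle_word eta xi) =
  ((if eta is y :: eta' then (y == x) * count_mem nu (shuffle_word eta' xi)
    else 0) +
   (if xi is y :: xi' then (y == x) * count_mem nu (shuffle_word eta xi')
    else 0))%N.
Proof.
have consE y l : count_mem (x :: nu) [seq y :: w | w <- l]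
               = ((y == x) * count_mem nu l)%N.
  rewrite count_map; case: (eqVneq y x) => [->|neq_yx].
    by rewrite mul1n; apply: eq_count => w /=; rewrite eqseq_cons eqxx.
  rewrite mul0n (@eq_count _ _ pred0) ?count_pred0 // => w /=.
  by rewrite eqseq_cons (negbTE neq_yx).
have nilE xi' : shuffle_word [::] xi' = [:: xi'] by case: xi'.
have nilEr eta' : shuffle_word eta' [::] = [:: eta'] by case: eta'.
case: eta xi => [|y eta] [|z xi]; rewrite ?nilE ?nilEr //=.
- by rewrite eqseq_cons !addn0 mulnb.
- by rewrite eqseq_cons !addn0 mulnb.
- by rewrite count_cat !consE.
Qed.

Lemma sum_words_le0 (F : word -> R) : \sum_(eta <- words_le 0) F eta = F [::].
Proof.
rewrite (perm_big [:: [::]]) ?big_seq1 //.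
apply: uniq_perm; rewrite ?uniq_words_le // => eta.
by rewrite mem_words_le leqn0 size_eq0 inE.
Qed.

Lemma sum_words_leS N (F : word -> R) :
  \sum_(eta <- words_le N.+1) F eta =
  F [::] + \sum_(y : letter) \sum_(eta <- words_le N) F (y :: eta).
Proof.
have perm_wordsS : perm_eq (words_le N.+1)
    ([::] :: [seq y :: eta | y <- enum {: letter}, eta <- words_le N]).
  apply: uniq_perm; first exact: uniq_words_le.
    rewrite /= allpairs_uniq ?enum_uniq ?uniq_words_le ?andbT //; last first.
      by move=> [y eta] [z xi] _ _ [-> ->].
    by apply/negP => /allpairsP[[y eta] [_ _]].
  move=> eta; rewrite mem_words_le inE; case: eta => [|y eta] //=.
  apply/idP/allpairsP => [le_eta | [[z xi] /= [_ + [_ ->]]]].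
    by exists (y, eta); rewrite mem_enum mem_words_le.
  by rewrite mem_words_le.
by rewrite (perm_big _ perm_wordsS) big_cons big_allpairs_dep big_enum.
Qed.

Lemma sum_words_le_widen N M (F : word -> R) : (N <= M)%N ->
    (forall eta, (N < size eta)%N -> F eta = 0) ->
  \sum_(eta <- words_le M) F eta = \sum_(eta <- words_le N) F eta.
Proof.
move=> le_NM F0; rewrite (bigID (fun eta : word => (size eta <= N)%N)) /=.
rewrite [X in _ + X]big1 ?addr0 => [|eta]; last by rewrite -ltnNge => /F0.
rewrite -big_filter; apply/perm_big/uniq_perm.
- exact/filter_uniq/uniq_words_le.
- exact: uniq_words_le.
move=> eta; rewrite mem_filter !mem_words_le andb_idr // => le_eta.
exact: leq_trans le_eta le_NM.
Qed.

Lemma shuffle_widen (c d : series) (nu : word) N : (size nu <= N)%N ->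
  shuffle c d nu = \sum_(eta <- words_le N) \sum_(xi <- words_le N)
    c eta * d xi * (count_mem nu (shuffle_word eta xi))%:R.
Proof.
move=> le_nu.
have count0 eta xi : (size nu < size eta + size xi)%N ->
    c eta * d xi * (count_mem nu (shuffle_word eta xi))%:R = 0.
  move=> lt_nu; rewrite (count_memPn _) ?mulr0 //.
  by apply/negP => /size_shuffle_word eq_nu; rewrite eq_nu ltnn in lt_nu.
rewrite [RHS](sum_words_le_widen le_nu) => [|eta lt_eta]; last first.
  by rewrite big1 // => xi _; rewrite count0 // ltn_addr.
apply: eq_bigr => eta _; rewrite (sum_words_le_widen le_nu) // => xi lt_xi.
by rewrite count0 // ltn_addl.
Qed.

Lemma shuffle_nil (c d : series) : shuffle c d [::] = c [::] * d [::].
Proof. by rewrite /shuffle !sum_words_le0 /= mulr1. Qed.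

(** Removing the first letter is a derivation of the shuffle product. With
    [shuffle_nil] this characterizes the product, and gives commutativity and
    associativity by induction on the word. *)
Lemma shuffle_cons (c d : series) (x : letter) (nu : word) :
  shuffle c d (x :: nu) =
  shuffle (lderiv x c) d nu + shuffle c (lderiv x d) nu.
Proof.
pose K eta xi (w : word) : R := (count_mem w (shuffle_word eta xi))%:R.
pose F (eta xi : word) : R :=
  if eta is y :: eta' then c eta * d xi * ((y == x)%:R * K eta' xi nu) else 0.
pose G (eta xi : word) : R :=
  if xi is y :: xi' then c eta * d xi * ((y == x)%:R * K eta xi' nu) else 0.
have pick (H : letter -> R) : \sum_y (y == x)%:R * H y = H x.
  rewrite (bigD1 x) //= eqxx mul1r big1 ?addr0 // => y /negbTE->.
  by rewrite mul0r.
have split_count eta xi : c eta * d xi * K eta xi (x :: nu)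
                        = F eta xi + G eta xi.
  rewrite /K count_shuffle_cons natrD mulrDr /F /G.
  by case: eta => [|y eta]; case: xi => [|z xi]; rewrite ?mulr0 ?natrM.
rewrite (@shuffle_widen _ _ _ (size nu).+1) //.
under eq_bigr do under eq_bigr do rewrite -/(K _ _ _) split_count.
under eq_bigr do rewrite big_split.
rewrite big_split /=; congr (_ + _).
  rewrite sum_words_leS big1_eq add0r.
  transitivity (\sum_(y : letter) (y == x)%:R *
      \sum_(eta <- words_le (size nu)) \sum_(xi <- words_le (size nu).+1)
         c (y :: eta) * d xi * K eta xi nu).
    apply: eq_bigr => y _; rewrite mulr_sumr; apply: eq_bigr => eta _.
    by rewrite mulr_sumr; apply: eq_bigr => xi _; rewrite /F mulrCA.
  rewrite pick; apply: eq_bigr => eta _.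
  rewrite (sum_words_le_widen (leqnSn _)) // => xi lt_xi.
  rewrite /K (count_memPn _) ?mulr0 //; apply/negP => /size_shuffle_word eq_nu.
  by rewrite eq_nu ltnNge leq_addl in lt_xi.
rewrite exchange_big /= sum_words_leS big1_eq add0r.
transitivity (\sum_(y : letter) (y == x)%:R *
    \sum_(xi <- words_le (size nu)) \sum_(eta <- words_le (size nu).+1)
       c eta * d (y :: xi) * K eta xi nu).
  apply: eq_bigr => y _; rewrite mulr_sumr; apply: eq_bigr => xi _.
  by rewrite mulr_sumr; apply: eq_bigr => eta _; rewrite /G mulrCA.
rewrite pick exchange_big /= (sum_words_le_widen (leqnSn _)) // => eta lt_eta.
rewrite big1 // => xi _.
rewrite /K (count_memPn _) ?mulr0 //; apply/negP => /size_shuffle_word eq_nu.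
by rewrite eq_nu ltnNge leq_addr in lt_eta.
Qed.

Lemma lderiv_shuffle (x : letter) (c d : series) :
  lderiv x (shuffle c d) =
  shuffle (lderiv x c) d \+ shuffle c (lderiv x d).
Proof. by apply: functional_extensionality => nu; apply: shuffle_cons. Qed.

Lemma shuffleC (c d : series) : shuffle c d = shuffle d c.
Proof.
apply: functional_extensionality => nu; elim: nu c d => [|x nu IH] c d.
  by rewrite !shuffle_nil mulrC.
by rewrite !shuffle_cons addrC IH [X in _ + X = _]IH.
Qed.

Lemma shuffle_sumr (I : Type) (r : seq I) (c : series) (k : I -> R)
    (f : I -> series) (nu : word) :
  shuffle c (fun w => \sum_(i <- r) k i * f i w) nu =
  \sum_(i <- r) k i * shuffle c (f i) nu.
Proof.
rewrite /shuffle; under [RHS]eq_bigr do rewrite mulr_sumr.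
rewrite [RHS]exchange_big; apply: eq_bigr => eta _ /=.
under [RHS]eq_bigr do rewrite mulr_sumr.
rewrite [RHS]exchange_big; apply: eq_bigr => xi _ /=.
rewrite mulr_sumr mulr_suml; apply: eq_bigr => i _.
by rewrite !mulrA (mulrC (c eta)).
Qed.

Lemma shuffleDr (c d e : series) :
  shuffle c (d \+ e) = shuffle c d \+ shuffle c e.
Proof.
apply: functional_extensionality => nu; rewrite /= /shuffle -big_split /=.
apply: eq_bigr => eta _; rewrite -big_split /=; apply: eq_bigr => xi _.
by rewrite mulrDr mulrDl.
Qed.

Lemma shuffleDl (c d e : series) :
  shuffle (c \+ d) e = shuffle c e \+ shuffle d e.
Proof. by rewrite !(shuffleC _ e) shuffleDr. Qed.

Lemma shuffleNl (c d : series) : shuffle (\- c) d = \- shuffle c d.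
Proof.
apply: functional_extensionality => nu; rewrite /= /shuffle -sumrN.
apply: eq_bigr => eta _; rewrite -sumrN; apply: eq_bigr => xi _.
by rewrite !mulNr.
Qed.

Lemma shuffleA (c d e : series) :
  shuffle c (shuffle d e) = shuffle (shuffle c d) e.
Proof.
apply: functional_extensionality => nu; elim: nu c d e => [|x nu IH] c d e.
  by rewrite !shuffle_nil mulrA.
by rewrite !shuffle_cons !lderiv_shuffle shuffleDr shuffleDl /= !IH addrA.
Qed.

Lemma shuffle0s (c : series) : shuffle (fun _ => 0) c = fun _ => 0.
Proof.
apply: functional_extensionality => nu; rewrite /shuffle big1 // => eta _.
by rewrite big1 // => xi _; rewrite !mul0r.
Qed.

Lemma shuffle1s (c : series) : shuffle sone c = c.
Proof.
apply: functional_extensionality => nu; elim: nu c => [|x nu IH] c.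
  by rewrite shuffle_nil /sone mul1r.
have deriv_one : lderiv x sone = fun _ => 0 by apply: functional_extensionality.
by rewrite shuffle_cons deriv_one shuffle0s add0r IH.
Qed.

(** * Systems determining a series letter by letter *)

(** The balls of the length ultrametric on series, for which the products are
    nonexpansive and prefixing a letter is contracting. *)
Definition agree (n : nat) (c d : series) :=
  forall nu : word, (size nu < n)%N -> c nu = d nu.

Definition nonexpansive (Phi : series -> series) :=
  forall n c d, agree n c d -> agree n (Phi c) (Phi d).

Lemma agree_shuffle n c c' d d' :
  agree n c c' -> agree n d d' -> agree n (shuffle c d) (shuffle c' d').
Proof.
move=> agr_c agr_d nu lt_nu; apply: eq_big_seq => eta; rewrite mem_words_le.
move=> le_eta; apply: eq_big_seq => xi; rewrite mem_words_le => le_xi.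
by rewrite agr_c ?agr_d // (leq_ltn_trans _ lt_nu).
Qed.

(** Uniqueness for nonexpansive systems: knowing the derivatives up to some
    length gives the series one letter further. *)
Lemma agree_lderiv_eq (c d : series) : c [::] = d [::] ->
  (forall x n, agree n c d -> agree n (lderiv x c) (lderiv x d)) -> c = d.
Proof.
move=> eq0 eqS; apply: functional_extensionality => nu.
suff agr n : agree n c d by apply: (agr (size nu).+1).
elim: n => [|n IH] // [|x w] // lt_w.
exact: (eqS x n IH w).
Qed.

(** Solved by Picard iteration: each step fixes the coefficients of one more
    length. *)
Lemma lderiv_system_solvable (k : R) (Phi : letter -> series -> series) :
    (forall x, nonexpansive (Phi x)) ->
  exists e : series, e [::] = k /\ forall x, lderiv x e = Phi x e.
Proof.
move=> nexp; pose step (e : series) : series :=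
  fun nu => if nu is x :: nu' then Phi x e nu' else k.
pose E n := iter n step (fun _ => 0).
have E_S n : agree n (E n) (E n.+1).
  by elim: n => [|n IH] // [|x w] // lt_w; apply: nexp IH _ lt_w.
have E_le n m : (n <= m)%N -> agree n (E n) (E m).
  move=> /subnK <-; elim: (m - n)%N => [|j IH] // nu lt_nu.
  by rewrite IH // addSn; apply: E_S; apply: ltn_addl.
exists (fun nu => E (size nu).+1 nu); split=> // x.
apply: functional_extensionality => nu; rewrite /lderiv /=.
apply: (nexp x (size nu).+1); last by [].
by move=> w lt_w; rewrite [RHS](E_le _ _ lt_w).
Qed.

(** * The modified composition product *)

Lemma mcomp_nil (c d : series) : mcomp c d [::] = c [::].
Proof. by rewrite /mcomp sum_words_le0 mulr1. Qed.

Lemma mcomp_cons (c d : series) (x : letter) (nu : word) :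
  mcomp c d (x :: nu) =
  \sum_(eta <- words_le (size nu))
    c (x0 :: eta) * phi_letter d x0 (phi d eta sone) (x :: nu) +
  \sum_(eta <- words_le (size nu))
    c (x1 :: eta) * phi_letter d x1 (phi d eta sone) (x :: nu).
Proof.
rewrite (@mcomp_widen _ _ _ (size nu).+1) // sum_words_leS /sone mulr0 add0r.
by rewrite big_bool addrC.
Qed.

Lemma lderiv1_mcomp (c d : series) :
  lderiv x1 (mcomp c d) = mcomp (lderiv x1 c) d.
Proof.
apply: functional_extensionality => nu; rewrite /lderiv mcomp_cons big1.
  by rewrite add0r; apply: eq_bigr => eta _; rewrite /phi_letter /= addr0.
by move=> eta _; rewrite /phi_letter /= mulr0.
Qed.

(** The extra term comes from the letters [x1] of [c], which the composition
    replaces with [x1 + x0 d]. *)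
Lemma lderiv0_mcomp (c d : series) :
  lderiv x0 (mcomp c d) =
  mcomp (lderiv x0 c) d \+ shuffle d (mcomp (lderiv x1 c) d).
Proof.
apply: functional_extensionality => nu; rewrite /lderiv /= mcomp_cons.
congr (_ + _); transitivity (shuffle d (fun w =>
    \sum_(eta <- words_le (size nu)) c (x1 :: eta) * phi d eta sone w) nu).
  rewrite shuffle_sumr; apply: eq_bigr => eta _.
  by rewrite /phi_letter /= add0r.
apply: (@agree_shuffle (size nu).+1) => // w lt_w.
by rewrite [RHS](@mcomp_widen _ _ _ (size nu)).
Qed.

Lemma mcompDl (c c' d : series) :
  mcomp (c \+ c') d = mcomp c d \+ mcomp c' d.
Proof.
apply: functional_extensionality => nu; rewrite /= /mcomp -big_split /=.
by apply: eq_bigr => eta _; rewrite mulrDl.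
Qed.

Lemma mcompNl (c d : series) : mcomp (\- c) d = \- mcomp c d.
Proof.
apply: functional_extensionality => nu; rewrite /= /mcomp -sumrN.
by apply: eq_bigr => eta _; rewrite mulNr.
Qed.

Lemma mcomp0l (d : series) : mcomp (fun _ => 0) d = fun _ => 0.
Proof.
apply: functional_extensionality => nu.
by rewrite /mcomp big1 // => eta _; rewrite mul0r.
Qed.

(** Both sides satisfy the recursion of [lderiv1_mcomp] and [lderiv0_mcomp]:
    removing a letter is a derivation, and the shuffle with [d] in the
    additional term commutes with the other shuffles. *)
Lemma mcomp_shuffle (c c' d : series) :
  mcomp (shuffle c c') d = shuffle (mcomp c d) (mcomp c' d).
Proof.
apply: functional_extensionality => nu.
suff agr n : forall b b',
    agree n (mcomp (shuffle b b') d) (shuffle (mcomp b d) (mcomp b' d)).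
  exact: (agr (size nu).+1).
elim: n => [|n IH] b b' // [|x w] lt_w.
  by rewrite shuffle_nil !mcomp_nil shuffle_nil.
have {}lt_w : (size w < n)%N by [].
rewrite shuffle_cons -[LHS]/(lderiv x (mcomp (shuffle b b') d) w); case: x.
  by rewrite !lderiv1_mcomp lderiv_shuffle mcompDl /= !IH.
rewrite !lderiv0_mcomp !lderiv_shuffle !mcompDl shuffleDl !shuffleDr /=.
rewrite !IH // [RHS]addrACA; congr (_ + _); congr (_ + _).
  rewrite -shuffleA.
  by apply: (@agree_shuffle n) => // u lt_u; apply: IH.
rewrite shuffleA (shuffleC (mcomp b d)) -shuffleA.
by apply: (@agree_shuffle n) => // u lt_u; apply: IH.
Qed.

(** * The feedback inverse of the series of factorials *)

Lemma fact_seriesE (nu : word) :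
  fact_series nu = if all (pred1 x1) nu then (size nu)`!%:R else 0.
Proof.
by rewrite /fact_series; congr (if _ then _ else _); apply/eqP/all_pred1P.
Qed.

(** Shuffling a word with the letter [x1] inserts that letter at every
    position, whence the factor [size nu] on a power of [x1]. *)
Lemma shuffle_x1 (c : series) (nu : word) :
  shuffle (lcons x1 sone) c nu =
  \sum_(i < size nu | nth x0 nu i == x1) c (take i nu ++ drop i.+1 nu).
Proof.
elim: nu c => [|x nu IH] c; first by rewrite shuffle_nil mul0r big_ord0.
have deriv_x1 : lderiv x (lcons x1 sone) = if x == x1 then sone else fun _ => 0.
  by apply: functional_extensionality => w; rewrite /lderiv /=; case: eqP.
rewrite shuffle_cons deriv_x1 IH [RHS]big_mkcond big_ord_recl /= drop0.
by rewrite -big_mkcond; congr (_ + _); case: eqP; rewrite ?shuffle1s ?shuffle0s.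
Qed.

(** In the shuffle algebra, the series of factorials is [1 / (1 - x1)]. *)
Lemma fact_series_geometric :
  fact_series = sone \+ shuffle (lcons x1 sone) fact_series.
Proof.
apply: functional_extensionality => nu /=; rewrite shuffle_x1.
case: nu => [|x nu]; first by rewrite big_ord0 addr0.
rewrite add0r; set w := x :: nu.
transitivity (\sum_(i < size w)
    if all (pred1 x1) w then (size nu)`!%:R else 0 : R).
  rewrite fact_seriesE sumr_const card_ord; case: ifP => _; last first.
    by rewrite mul0rn.
  by rewrite factS mulnC natrM mulr_natr.
rewrite [RHS]big_mkcond; apply: eq_bigr => i _; rewrite fact_seriesE.
have -> : all (pred1 x1) w =
    (nth x0 w i == x1) && all (pred1 x1) (take i w ++ drop i.+1 w).
  by rewrite -{1}(cat_take_drop i w) (drop_nth x0) // !all_cat /= andbCA.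
have -> : size (take i w ++ drop i.+1 w) = size nu.
  by rewrite size_cat size_take size_drop ltn_ord subnKC // -ltnS.
by case: (nth x0 w i == x1).
Qed.

(** The derivative along [x1] of [1 / (1 - x1)] is [1 / (1 - x1) ^ 2]. *)
Lemma fact_series_system :
  [/\ fact_series [::] = 1, lderiv x0 fact_series = (fun _ => 0)
    & lderiv x1 fact_series = shuffle fact_series fact_series].
Proof.
split.
- by [].
- by apply: functional_extensionality => nu; rewrite /lderiv fact_seriesE.
set c := fact_series; pose X := lcons x1 sone.
have deriv_one : lderiv x1 sone = fun _ => 0.
  by apply: functional_extensionality.
have deriv_X : lderiv x1 X = sone by apply: functional_extensionality.
have deriv_c : lderiv x1 c = c \+ shuffle X (lderiv x1 c).
  have /(congr1 (lderiv x1)) := fact_series_geometric.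
  have -> : lderiv x1 (sone \+ shuffle X c)
          = lderiv x1 sone \+ lderiv x1 (shuffle X c) by [].
  rewrite deriv_one lderiv_shuffle deriv_X shuffle1s => {1}->.
  by apply: functional_extensionality => w /=; rewrite add0r.
(* For [D = lderiv x1 c], subtract [D] times [c = 1 + x1 c] from [c] times
   [D = c + x1 D]. *)
apply: functional_extensionality => nu.
have /(congr1 (shuffle^~ (lderiv x1 c)))/(congr1 (@^~ nu)) :=
  fact_series_geometric.
have /(congr1 (shuffle c))/(congr1 (@^~ nu)) := deriv_c.
rewrite shuffleDr shuffleDl shuffle1s /= => -> /eqP.
by rewrite shuffleA (shuffleC c X) -/c -/X addrC [in X in _ == X]addrC;
   rewrite (inj_eq (addrI _)) => /eqP.
Qed.

(** The Abel equation on series: the inputs [beta] and [alpha] are attached to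
    the letters [x1] and [x0], and multiply [z ^ 2] and [z ^ 3]. *)
Definition abel_system (e : series) : Prop :=
  [/\ e [::] = 1, lderiv x1 e = shuffle e e
    & lderiv x0 e = shuffle e (shuffle e e)].

(** Composition with [d] is a morphism, and carries the system of
    [fact_series_system] to one in which [x1] is replaced with [x1 + x0 d]. *)
Lemma mcomp_fact_series (d : series) :
  let g := mcomp fact_series d in
  [/\ g [::] = 1, lderiv x1 g = shuffle g g
    & lderiv x0 g = shuffle d (shuffle g g)].
Proof.
have [c_nil c_x0 c_x1] := fact_series_system.
split; first by rewrite mcomp_nil.
  by rewrite lderiv1_mcomp c_x1 mcomp_shuffle.
rewrite lderiv0_mcomp c_x0 c_x1 mcomp_shuffle mcomp0l.
by apply: functional_extensionality => w /=; rewrite add0r.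
Qed.

(** A right inverse of the opposite of the series of factorials is a fixed
    point of composition on the left with that series; for [d] equal to the
    composite, the system of [mcomp_fact_series] is the Abel system. *)
Lemma right_inverse_abel_system (e : series) :
  Defs.fgmul (\- fact_series) e =1 fgunit -> abel_system e.
Proof.
move=> inv_e; have fix_e : mcomp fact_series e = e.
  apply: functional_extensionality => nu; have := inv_e nu.
  by rewrite /Defs.fgmul mcompNl /fgunit /= => /eqP; rewrite subr_eq0 => /eqP.
by have := mcomp_fact_series e; rewrite /= fix_e.
Qed.

(** On each side of the group law, the two series to be identified satisfy the
    same system of equations. *)
Lemma abel_system_fginv (e : series) :
  abel_system e -> is_fginv (\- fact_series) e.
Proof.
move=> [e_nil e_x1 e_x0]; have [c_nil c_x0 c_x1] := fact_series_system.
split=> nu; rewrite /Defs.fgmul /fgunit /=.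
  have [g_nil g_x1 g_x0] := mcomp_fact_series e.
  suff {1}-> : e = mcomp fact_series e by rewrite mcompNl /= subrr.
  apply: agree_lderiv_eq => [|[] n agr]; first by rewrite e_nil g_nil.
    by rewrite e_x1 g_x1; apply: agree_shuffle.
  by rewrite e_x0 g_x0; apply: agree_shuffle => //; apply: agree_shuffle.
suff -> : mcomp e (\- fact_series) = fact_series by rewrite addNr.
apply: agree_lderiv_eq => [|[] n agr]; first by rewrite mcomp_nil e_nil.
  rewrite lderiv1_mcomp e_x1 mcomp_shuffle c_x1.
  exact: agree_shuffle.
rewrite lderiv0_mcomp e_x0 e_x1 !mcomp_shuffle c_x0 shuffleNl => w lt_w /=.
apply/eqP; rewrite subr_eq0; apply/eqP.
by apply: agree_shuffle lt_w => //; apply: agree_shuffle.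
Qed.

Lemma abel_system_solvable : exists e, abel_system e.
Proof.
pose Phi (x : letter) (e : series) :=
  if x == x1 then shuffle e e else shuffle e (shuffle e e).
have [|e [e_nil e_deriv]] := @lderiv_system_solvable 1 Phi.
  by move=> [] n c d agr; do ?[apply: agree_shuffle => //].
by exists e; split=> //; apply: e_deriv.
Qed.

Lemma is_fginv_fginv : is_fginv (\- fact_series) (fginv (\- fact_series)).
Proof.
apply: epsilon_spec; have [e /abel_system_fginv inv_e] := abel_system_solvable.
by exists e.
Qed.

Lemma fginv_abel_system : abel_system (fginv (\- fact_series)).
Proof. by apply: right_inverse_abel_system; case: is_fginv_fginv. Qed.

(** * Evaluation of monomials *)

Lemma mon_evalEw (c : series) (m : mon) (dom : {fset word}) :
  (finsupp m `<=` dom)%fset -> mon_eval c m = \prod_(eta <- dom) c eta ^+ m eta.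
Proof.
move=> sub; rewrite /mon_eval (big_fset_incl _ sub) // => eta _.
by rewrite -cmE_neq0 negbK => /eqP ->.
Qed.

Lemma mon_eval_is_mmorphism (c : series) : mmorphism (mon_eval c).
Proof.
split=> [m m'|]; last by rewrite /mon_eval mdom1 big_seq_fset0.
have sub_l : (finsupp m `<=` finsupp (mmul m m'))%fset.
  by rewrite mdomD fsubsetUl.
have sub_r : (finsupp m' `<=` finsupp (mmul m m'))%fset.
  by rewrite mdomD fsubsetUr.
rewrite (mon_evalEw c sub_l) (mon_evalEw c sub_r) /mon_eval -big_split /=.
by apply: eq_bigr => eta _; rewrite cmM exprD.
Qed.

HB.instance Definition _ (c : series) :=
  isMultiplicative.Build mon R (mon_eval c) (mon_eval_is_mmorphism c).

Lemma mon_eval_ucm (c : series) (eta : word) : mon_eval c (ucm eta) = c eta.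
Proof. by rewrite -heval_coordf /heval mmapU mul1r. Qed.

Definition mon_eval2 (c d : series) (p : mon * mon) :=
  mon_eval c p.1 * mon_eval d p.2.

Lemma mon_eval2_is_mmorphism (c d : series) : mmorphism (mon_eval2 c d).
Proof.
split=> [p q|]; last first.
  by rewrite -[LHS]/(mon_eval c mone * mon_eval d mone) !mmorph1 mulr1.
rewrite -[LHS]/(mon_eval c (mmul p.1 q.1) * mon_eval d (mmul p.2 q.2)).
by rewrite !mmorphM mulrACA.
Qed.

HB.instance Definition _ (c d : series) :=
  isMultiplicative.Build (mon * mon)%type R (mon_eval2 c d)
    (mon_eval2_is_mmorphism c d).

Lemma heval2E (c d : series) : heval2 c d = mmap idfun (mon_eval2 c d).
Proof. by []. Qed.

Lemma cmon_ind (P : mon -> Prop) : P mone ->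
  (forall eta m, P m -> P (mmul (ucm eta) m)) -> forall m, P m.
Proof.
move=> P1 PM m; move: {2}(mdeg m) (erefl (mdeg m)) => n.
elim: n m => [|n IH] m deg_m; first by rewrite (mdeg_eq0I deg_m).
have [m1|[eta eta_m]] := fset_0Vmem (finsupp m).
  by move: deg_m; rewrite mdegE m1 big_seq_fset0.
have m_eta : m = mmul (ucm eta) (divcm m (ucm eta)).
  apply/eqP/cmP => xi; rewrite cmM divcmE cmU subnKC //.
  by case: eqP => [<-|] //; rewrite lt0n cmE_neq0.
rewrite m_eta; apply/PM/IH/succn_inj.
by rewrite -deg_m {2}m_eta mdegM mdegU.
Qed.

(** Artin's theorem: pairwise distinct characters are linearly
    independent. *)
Lemma characters_independent (X : Type) (mulX : X -> X -> X) (oneX : X)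
    (K : eqType) (h : K -> X -> R) :
    (forall k x y, h k (mulX x y) = h k x * h k y) ->
    (forall k, h k oneX = 1) ->
    (forall k k', k != k' -> exists x, h k x != h k' x) ->
  forall (s : seq K) (a : K -> R), uniq s ->
    (forall x, \sum_(k <- s) a k * h k x = 0) -> forall k, k \in s -> a k = 0.
Proof.
move=> hM h1 h_sep; elim=> [|k s IH] a //= /andP[k_s uniq_s] sum0.
have a_s k' : k' \in s -> a k' = 0.
  move=> k'_s; have [|y sep_y] := h_sep k' k.
    by apply: contraNneq k_s => <-.
  have := IH (fun i => a i * (h i y - h k y)) uniq_s _ k' k'_s.
  (* Comparing the relation at [x y] with [h k y] times the relation at [x]
     eliminates the character [k]. *)
  move=> a_sep; apply/eqP; have : a k' * (h k' y - h k y) == 0.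
    apply/eqP/a_sep => x.
    transitivity (\sum_(i <- k :: s) a i * (h i y - h k y) * h i x).
      by rewrite big_cons subrr mulr0 mul0r add0r.
    transitivity (\sum_(i <- k :: s) a i * h i (mulX x y) -
                  h k y * \sum_(i <- k :: s) a i * h i x); last first.
      by rewrite !sum0 mulr0 subr0.
    rewrite mulr_sumr -sumrB; apply: eq_bigr => i _.
    rewrite hM mulrBr mulrBl -mulrA (mulrC (h i y)); congr (_ - _).
    by rewrite mulrA (mulrC (h k y)).
  by rewrite mulf_eq0 subr_eq0 (negbTE sep_y) orbF.
move=> k'; rewrite inE => /orP[/eqP-> | /a_s //].
have := sum0 oneX; rewrite big_cons h1 mulr1 big_seq big1 ?addr0 // => i i_s.
by rewrite a_s ?mul0r.
Qed.

Lemma mon_eval2_separates (p q : mon * mon) : p != q ->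
  exists x : series * series, mon_eval2 x.1 x.2 p != mon_eval2 x.1 x.2 q.
Proof.
(* Two has pairwise distinct powers. *)
pose two eta : series := fun xi => if xi == eta then 2%:R else 1%:R.
have eval_two eta m : mon_eval (two eta) m = 2%:R ^+ m eta.
  elim/cmon_ind: m => [|xi m IH]; first by rewrite mmorph1 cm1.
  rewrite mmorphM /= IH mon_eval_ucm cmM cmU exprD /two.
  by case: eqP.
have eval_one m : mon_eval (fun _ => 1) m = 1.
  by rewrite /mon_eval big1 // => eta _; rewrite expr1n.
have two_inj : injective (GRing.exp (2%:R : R)).
  apply: Num.Theory.ieexprIn; first exact: Num.Theory.ltr0Sn.
  by rewrite Num.Theory.pnatr_eq1.
have mon_sep (m m' : mon) : m != m' ->
    exists eta, (2%:R : R) ^+ m eta != 2%:R ^+ m' eta.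
  move=> neq_m; apply: NNPP => eq_m; case/eqP: neq_m; apply/eqP/cmP => eta.
  apply: two_inj; apply: NNPP => neq; apply: eq_m.
  by exists eta; apply/eqP.
case: p q => [m1 m2] [k1 k2]; have [<-|neq1 _] := eqVneq m1 k1.
  have [<-|/mon_sep[eta neq2] _] := eqVneq m2 k2; first by rewrite eqxx.
  exists (fun _ => 1, two eta).
  by rewrite /mon_eval2 !eval_one !mul1r !eval_two.
have [eta neq] := mon_sep _ _ neq1.
by exists (two eta, fun _ => 1); rewrite /mon_eval2 !eval_one !mulr1 !eval_two.
Qed.

(** A polynomial function over the reals determines the polynomial: distinct
    monomials are distinct characters of the series under the coefficientwise
    product. *)
Lemma heval2_inj (T U : Halg2) :
  (forall c d, heval2 c d T = heval2 c d U) -> T = U.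
Proof.
move=> eq_TU; apply/eqP; rewrite -subr_eq0; set V := T - U.
pose mulX (x y : series * series) : series * series :=
  (fun eta => x.1 eta * y.1 eta, fun eta => x.2 eta * y.2 eta).
have evalM c d m : mon_eval (fun eta => c eta * d eta) m
                 = mon_eval c m * mon_eval d m.
  by rewrite /mon_eval -big_split; apply: eq_bigr => eta _; rewrite exprMn.
have eval_one m : mon_eval (fun _ => 1) m = 1.
  by rewrite /mon_eval big1 // => eta _; rewrite expr1n.
have coef0 := @characters_independent _ mulX (fun _ => 1, fun _ => 1) _
  (fun p x => mon_eval2 x.1 x.2 p) _ _ mon_eval2_separates (msupp V)
  (fun p => V@_p) (fset_uniq _).
apply/eqP/malgP => p; rewrite mcoeff0.
case: (msuppP V p) => // p_V; apply: coef0 p_V => //.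
- by move=> q x y; rewrite /mon_eval2 /= !evalM mulrACA.
- by move=> q; rewrite /mon_eval2 !eval_one mulr1.
move=> x; rewrite -[LHS]/(mmap idfun (mon_eval2 x.1 x.2) V) mmapB.
by apply/eqP; rewrite subr_eq0; apply/eqP/eq_TU.
Qed.

(** * The antipode *)

(** For the length of a word plus one as the weight of its generator, the
    right-hand factors of the reduced coproduct of a generator have smaller
    weight than this generator. *)
Definition weight (m : mon) : nat :=
  (\sum_(eta <- finsupp m) m eta * (size eta).+1)%N.

Lemma weightEw (m : mon) (dom : {fset word}) : (finsupp m `<=` dom)%fset ->
  weight m = (\sum_(eta <- dom) m eta * (size eta).+1)%N.
Proof.
move=> sub; rewrite /weight (big_fset_incl _ sub) // => eta _.
by rewrite -cmE_neq0 negbK => /eqP ->.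
Qed.

Lemma weight1 : weight mone = 0%N.
Proof. by rewrite /weight mdom1 big_seq_fset0. Qed.

Lemma weightM (m m' : mon) : weight (mmul m m') = (weight m + weight m')%N.
Proof.
have sub_l : (finsupp m `<=` finsupp (mmul m m'))%fset.
  by rewrite mdomD fsubsetUl.
have sub_r : (finsupp m' `<=` finsupp (mmul m m'))%fset.
  by rewrite mdomD fsubsetUr.
rewrite (weightEw sub_l) (weightEw sub_r) /weight -big_split /=.
by apply: eq_bigr => eta _; rewrite cmM mulnDl.
Qed.

Lemma weight_ucm (eta : word) : weight (ucm eta) = (size eta).+1.
Proof. by rewrite /weight mdomU big_seq_fset1 cmUU mul1n. Qed.

Definition weight_lt (n : nat) (T : Halg2) :=
  forall p, p \in msupp T -> (weight p.2 < n)%N.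

Lemma weight_lt_le n k T : (n <= k)%N -> weight_lt n T -> weight_lt k T.
Proof. by move=> le_nk lt_T p /lt_T lt_p; apply: leq_trans lt_p le_nk. Qed.

Lemma weight_lt0 n : weight_lt n 0.
Proof. by move=> p; rewrite msupp0 in_fset0. Qed.

Lemma weight_ltU n k p : (weight p.2 < n)%N -> weight_lt n << k *g p >>.
Proof. by move=> lt_p q /(fsubsetP msuppU_le); rewrite in_fset1 => /eqP->. Qed.

Lemma weight_ltD n T U :
  weight_lt n T -> weight_lt n U -> weight_lt n (T + U).
Proof.
move=> lt_T lt_U p /(fsubsetP (msuppD_le _ _)).
by rewrite in_fsetU => /orP[/lt_T | /lt_U].
Qed.

Lemma weight_ltM n k T U :
  weight_lt n.+1 T -> weight_lt k.+1 U -> weight_lt (n + k).+1 (T * U).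
Proof.
move=> lt_T lt_U _ /msuppM_le[p [q [/lt_T lt_p /lt_U lt_q ->]]].
rewrite -[(mmul p q).2]/(mmul p.2 q.2) weightM ltnS.
by apply: leq_add; rewrite -ltnS.
Qed.

(** A bound on the weight is first found for the function, by following its
    recursive definition, and then carried to the reduced coproduct, which
    represents the function, by [heval2_inj]. *)
Definition poly_fun (n : nat) (F : series -> series -> R) :=
  exists2 T, weight_lt n.+1 T & forall c d, heval2 c d T = F c d.

Lemma poly_fun_ext n F G : (forall c d, F c d = G c d) ->
  poly_fun n F -> poly_fun n G.
Proof. by move=> eqFG [T lt_T evT]; exists T => // c d; rewrite evT eqFG. Qed.

Lemma poly_fun_le n k F : (n <= k)%N -> poly_fun n F -> poly_fun k F.
Proof.
by move=> le_nk [T lt_T evT]; exists T => //; apply: weight_lt_le lt_T.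
Qed.

Lemma poly_funC n (k : R) : poly_fun n (fun _ _ => k).
Proof.
exists << k *g mone >>; first by apply: weight_ltU; rewrite weight1.
by move=> c d; rewrite heval2E mmapU mmorph1 mulr1.
Qed.

Lemma poly_fun_fst (eta : word) : poly_fun 0 (fun c _ => c eta).
Proof.
exists << (ucm eta, mone) >>; first by apply: weight_ltU; rewrite weight1.
move=> c d.
by rewrite heval2E mmapU /mon_eval2 mmorph1 mon_eval_ucm mulr1 mul1r.
Qed.

Lemma poly_fun_snd (eta : word) : poly_fun (size eta).+1 (fun _ d => d eta).
Proof.
exists << (mone, ucm eta) >>; first by apply: weight_ltU; rewrite weight_ucm.
by move=> c d; rewrite heval2E mmapU /mon_eval2 mmorph1 mon_eval_ucm !mul1r.
Qed.

Lemma poly_funD n F G : poly_fun n F -> poly_fun n G ->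
  poly_fun n (fun c d => F c d + G c d).
Proof.
move=> [T lt_T evT] [U lt_U evU]; exists (T + U); first exact: weight_ltD.
by move=> c d; rewrite heval2E mmapD -heval2E evT evU.
Qed.

Lemma poly_funM n k F G : poly_fun n F -> poly_fun k G ->
  poly_fun (n + k) (fun c d => F c d * G c d).
Proof.
move=> [T lt_T evT] [U lt_U evU]; exists (T * U); first exact: weight_ltM.
by move=> c d; rewrite heval2E rmorphM /= -heval2E evT evU.
Qed.

Lemma poly_fun_sum (I : eqType) (r : seq I) n (F : I -> series -> series -> R) :
  (forall i, i \in r -> poly_fun n (F i)) ->
  poly_fun n (fun c d => \sum_(i <- r) F i c d).
Proof.
elim: r => [|i r IH] polyF.
  by apply: poly_fun_ext (poly_funC n 0) => c d; rewrite big_nil.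
apply: (@poly_fun_ext _ (fun c d => F i c d + \sum_(i <- r) F i c d)).
  by move=> c d; rewrite big_cons.
apply: poly_funD; first by apply: polyF; rewrite mem_head.
by apply: IH => j j_r; apply: polyF; rewrite inE j_r orbT.
Qed.

(** Each factor [d] entering [phi d eta] is shuffled below a new letter [x0],
    which pays for the additional unit in the weight of its coefficients. *)
Lemma poly_fun_phi (eta nu : word) :
  poly_fun (size nu) (fun _ d => phi d eta sone nu).
Proof.
elim: eta nu => [|x eta IH] nu; first exact: poly_funC.
case: nu => [|y nu].
  by apply: poly_fun_ext (poly_funC _ 0) => c d; rewrite /phi /= /phi_letter;
     case: ifP => //= _; rewrite addr0.
have IHS : poly_fun (size nu).+1 (fun _ d => phi d eta sone nu).
  by apply: poly_fun_le (IH nu).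
have shuf : poly_fun (size nu).+1 (fun _ d => shuffle d (phi d eta sone) nu).
  rewrite /shuffle; apply: poly_fun_sum => xi _; apply: poly_fun_sum => rho _.
  have [lt_nu|le_nu] := ltnP (size nu) (size xi + size rho).
    apply: poly_fun_ext (poly_funC _ 0) => c d.
    rewrite (count_memPn _) ?mulr0 //; apply/negP => /size_shuffle_word eq_nu.
    by rewrite eq_nu ltnn in lt_nu.
  apply: (@poly_fun_le ((size xi).+1 + size rho + 0)); first by rewrite addn0.
  apply: (poly_funM _ (poly_funC 0 _)).
  exact: (poly_funM (poly_fun_snd xi) (IH rho)).
have zero : poly_fun (size nu).+1 (fun _ _ => 0) by apply: poly_funC.
by rewrite /= /phi_letter; case: x; case: y => //=; apply: poly_funD.
Qed.

Lemma poly_fun_mcomp (eta : word) :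
  poly_fun (size eta) (fun c d => mcomp c d eta).
Proof.
apply: poly_fun_sum => xi _; apply: (poly_funM (poly_fun_fst xi)).
exact: poly_fun_phi.
Qed.

Lemma reduced_coproduct_weight (Dred : word -> Halg2) (eta : word) :
  is_reduced_coproduct Dred -> weight_lt (size eta).+1 (Dred eta).
Proof.
move=> eval_Dred; have [T lt_T eval_T] := poly_fun_mcomp eta.
suff -> : Dred eta = T by [].
by apply: heval2_inj => c d; rewrite eval_Dred eval_T.
Qed.

Lemma big_msuppU (K : choiceType) (V : zmodType) (k : K) (F : K -> R -> V) :
  let g := << k >> : {malg R[K]} in \sum_(m <- msupp g) F m g@_m = F k 1.
Proof. by rewrite /= msuppU oner_eq0 big_seq_fset1 mcoeffUU. Qed.

Lemma malgU1M (K : monomType) (k k' : K) :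
  << mmul k k' >> = << k >> * << k' >> :> {malg R[K]}.
Proof. by rewrite malgME !msuppU1 !big_seq_fset1 !mcoeffUU mulr1. Qed.

(** Names for basis elements, typed so that products and supports refer to the
    monomial structures of the two algebras. *)
Definition hmon (m : mon) : Halg := << m >>.
Definition htens (m m' : mon) : Halg2 := << (m, m') >>.

Lemma hmonM (m m' : mon) : hmon (mmul m m') = hmon m * hmon m'.
Proof. exact: malgU1M. Qed.

Lemma htensM (m m' k k' : mon) :
  htens (mmul m k) (mmul m' k') = htens m m' * htens k k'.
Proof. exact: (malgU1M ((m, m') : mon * mon) (k, k')). Qed.

Lemma tensor1_coordf (eta : word) :
  tensor 1 (coordf eta) = htens mone (ucm eta).
Proof.
have sum1 := @big_msuppU mon Halg2 mone
  (fun m a => \sum_(m' <- msupp (coordf eta))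
                << a * (coordf eta)@_m' *g (m, m') >>).
have sum_eta := @big_msuppU mon Halg2 (ucm eta)
  (fun m' a => << 1 * a *g (mone, m') >>).
apply: (etrans sum1); apply: (etrans sum_eta); rewrite mulr1.
exact: erefl.
Qed.

(** On a monomial of generators the coproduct is the product of those of the
    generators, each of which has a single term of top weight on the right. *)
Lemma coproduct_triangular (Delta : {lrmorphism Halg -> Halg2}) (m : mon) :
  is_coproduct Delta ->
  exists2 L, weight_lt (weight m) L & Delta (hmon m) = htens mone m + L.
Proof.
move=> [Dred eval_Dred DeltaE]; elim/cmon_ind: m => [|eta m [L lt_L Delta_m]].
  exists 0; first exact: weight_lt0.
  by rewrite addr0; apply: rmorph1.
have lt_Dred := @reduced_coproduct_weight _ eta eval_Dred.
have lt_Delta_eta : weight_lt (size eta).+2 (Dred eta + htens mone (ucm eta)).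
  apply: weight_ltD; first exact: weight_lt_le lt_Dred.
  by apply: weight_ltU; rewrite weight_ucm.
exists (Dred eta * htens mone m + (Dred eta + htens mone (ucm eta)) * L).
  rewrite weightM weight_ucm addSn; apply: weight_ltD.
    by apply: weight_ltM => //; apply: weight_ltU.
  have [w0|w_gt0] := posnP (weight m).
    suff -> : L = 0 by rewrite mulr0; apply: weight_lt0.
    apply/eqP; rewrite -msupp_eq0; apply/eqP/fsetP => p; rewrite in_fset0.
    by apply/negP => /lt_L; rewrite w0.
  rewrite -addSn -(prednK w_gt0) addnS.
  apply: weight_ltM; first exact: lt_Delta_eta.
  by rewrite prednK.
transitivity (Delta (coordf eta) * Delta (hmon m)).
  by rewrite hmonM; apply: (rmorphM Delta).
rewrite [X in _ * X = _]Delta_m DeltaE tensor1_coordf.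
rewrite mulrDr addrA [X in X + _ = _]mulrDl [X in X + _ = _]addrC.
by rewrite -(htensM mone) mul1m.
Qed.

(** A functional is determined by its convolution with the evaluation at [c]:
    triangularity of the coproduct makes this a recursion on the weight. *)
Lemma convolution_cancel (Delta : {lrmorphism Halg -> Halg2}) (c : series)
    (f g : mon -> R) :
    is_coproduct Delta ->
    (forall m,
       mmap idfun (fun p => mon_eval c p.1 * f p.2) (Delta (hmon m)) =
       mmap idfun (fun p => mon_eval c p.1 * g p.2) (Delta (hmon m))) ->
  f =1 g.
Proof.
move=> coprod eq_conv m; move: {2}(weight m).+1 (ltnSn (weight m)) => n.
elim: n m => [|n IH] m // le_m.
have [L lt_L Delta_m] := coproduct_triangular m coprod.
have := eq_conv m; rewrite Delta_m !mmapD.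
have -> : mmap idfun (fun p => mon_eval c p.1 * f p.2) L =
          mmap idfun (fun p => mon_eval c p.1 * g p.2) L.
  apply: eq_big_seq => p /lt_L lt_p; rewrite IH //.
  exact: leq_trans lt_p _.
by move/addIr; rewrite !mmapU /= !mmorph1 !mul1r.
Qed.

(** The convolution of the evaluations at [c] and [d] is the evaluation at
    their group product, that is, the counit. So is the convolution of the
    evaluation at [c] with its composite with the antipode, and the evaluation
    at [c] can be cancelled. *)
Lemma antipode_eval (Delta : {lrmorphism Halg -> Halg2})
    (S : {linear Halg -> Halg}) (c d : series) (eta : word) :
    is_coproduct Delta -> is_antipode Delta S ->
    Defs.fgmul c d =1 fgunit ->
  heval c (S (coordf eta)) = d eta.
Proof.
move=> coprod antipode inv_d.
have counitE m : counit (hmon m) = mon_eval (fun _ => 0) m.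
  by rewrite /counit /heval /hmon mmapU mul1r.
rewrite -(mon_eval_ucm d).
apply: (@convolution_cancel Delta c (fun m => heval c (S (hmon m))) _ coprod).
move=> m; transitivity (counit (hmon m)).
  have [_ /(congr1 (heval c))] := antipode (hmon m).
  rewrite /heval mmapZ mmap1 mulr1 /= => <-.
  rewrite /conv raddf_sum; apply: eq_bigr => p _ /=.
  by rewrite mmapZ rmorphM /= mmapU mul1r.
rewrite counitE -[RHS]/(heval2 c d (Delta (hmon m))).
have [Dred eval_Dred DeltaE] := coprod.
elim/cmon_ind: m => [|xi m _].
  rewrite mmorph1 (rmorph1 Delta) heval2E.
  by symmetry; apply: (rmorph1 (mmap idfun (mon_eval2 c d))).
have inv_xi : heval2 c d (Delta (coordf xi)) = 0.
  rewrite DeltaE tensor1_coordf heval2E mmapD -heval2E eval_Dred addrC heval2E.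
  rewrite /htens mmapU /mon_eval2 mmorph1 mon_eval_ucm !mul1r.
  exact: inv_d.
have DeltaM : Delta (hmon (mmul (ucm xi) m)) =
              Delta (coordf xi) * Delta (hmon m).
  by rewrite hmonM; apply: (rmorphM Delta).
rewrite mmorphM /= mon_eval_ucm mul0r DeltaM.
transitivity (heval2 c d (Delta (coordf xi)) * heval2 c d (Delta (hmon m))).
  by rewrite [X in _ = X * _]inv_xi mul0r.
by symmetry; apply: (rmorphM (mmap idfun (mon_eval2 c d))).
Qed.

(** * Iterated integrals *)

Lemma is_derive_continuous (f : R -> R) (t l : R) :
  is_derive f t l -> continuous f t.
Proof. by move=> df; apply: ex_derive_continuous; exists l. Qed.

(** Derivatives are required inside the segment only: at an endpoint of the
    interval of definition they may exist on one side only. *)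
Lemma eq_is_derive_segment (f g h : R -> R) (t : R) :
    (forall x, Rlt (Rmin 0 t) x -> Rlt x (Rmax 0 t) ->
       is_derive f x (h x) /\ is_derive g x (h x)) ->
    (forall x, continuous f x) -> (forall x, continuous g x) ->
  f 0 = g 0 -> f t = g t.
Proof.
move=> dfg f_cont g_cont eq0.
have [x [lt_x gt_x]|x _|c [_]] :=
  @MVT_gen (fun s => f s - g s) 0 t (fun _ => 0).
- have [df dg] := dfg x lt_x gt_x.
  have := is_derive_minus f g x _ _ df dg.
  by rewrite /minus -[plus _ _]/(h x - h x) subrr.
- apply/continuity_pt_filterlim.
  exact: (continuous_minus f g x (f_cont x) (g_cont x)).
rewrite !RminusE RmultE eq0 subrr subr0 mul0r => /eqP.
by rewrite subr_eq0 => /eqP.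
Qed.

Lemma ext_is_derive (f g h : R -> R) :
    (forall t, is_derive f t (h t)) -> (forall t, is_derive g t (h t)) ->
  f 0 = g 0 -> f =1 g.
Proof.
move=> df dg eq0 t; apply: (@eq_is_derive_segment f g h) => // x.
- exact: is_derive_continuous.
- exact: is_derive_continuous.
Qed.

Lemma is_deriveR_ext (f g : R -> R) (t l : R) :
  f =1 g -> is_derive f t l -> is_derive g t l.
Proof. by move=> eq_fg; apply: is_derive_ext. Qed.

Lemma is_deriveR_const (k t : R) : is_derive (fun _ => k) t 0.
Proof. exact: is_derive_const. Qed.

Lemma is_deriveRD (f g : R -> R) (t df dg : R) : is_derive f t df ->
  is_derive g t dg -> is_derive (fun s => f s + g s) t (df + dg).
Proof. exact: is_derive_plus. Qed.

Lemma is_deriveRM (f g : R -> R) (t df dg : R) : is_derive f t df ->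
  is_derive g t dg ->
  is_derive (fun s => f s * g s) t (df * g t + f t * dg).
Proof.
by move=> Df Dg; apply: (is_derive_mult f g t df dg Df Dg Rmult_comm).
Qed.

Lemma is_deriveRZ (k : R) (f : R -> R) (t l : R) :
  is_derive f t l -> is_derive (fun s => k * f s) t (k * l).
Proof. exact: is_derive_scal. Qed.

Lemma is_derive_sum (I : eqType) (r : seq I) (f g : I -> R -> R) (t : R) :
  (forall i, i \in r -> is_derive (f i) t (g i t)) ->
  is_derive (fun s => \sum_(i <- r) f i s) t (\sum_(i <- r) g i t).
Proof.
elim: r => [|i r IH] df.
  rewrite big_nil; apply: (is_deriveR_ext (f := fun _ => 0)) => [s|].
    by rewrite big_nil.
  exact: is_deriveR_const.
rewrite big_cons.
apply: (is_deriveR_ext (f := fun s => f i s + \sum_(i <- r) f i s)) => [s|].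
  by rewrite big_cons.
apply: is_deriveRD; first by apply: df; rewrite mem_head.
by apply: IH => j j_r; apply: df; rewrite inE j_r orbT.
Qed.

Section ContinuousInput.

Variable u : letter -> R -> R.
Hypothesis u_continuous : forall x t, continuous (u x) t.

Lemma is_derive_iterint_continuous (x : letter) (eta : word) :
  (forall t, continuous (iterint u eta) t) ->
  forall t, is_derive (iterint u (x :: eta)) t (u x t * iterint u eta t).
Proof.
move=> E_cont t.
have uE_cont s : continuous (fun s => u x s * iterint u eta s) s.
  exact: (continuous_mult (u x) (iterint u eta)).
apply: (@is_derive_RInt _ (fun s => u x s * iterint u eta s) _ 0) => //.
apply: filter_forall => s; apply: RInt_correct; apply: ex_RInt_continuous.
by move=> z _.
Qed.

Lemma iterint_continuous (eta : word) (t : R) : continuous (iterint u eta) t.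
Proof.
elim: eta t => [|x eta IH] t; first exact: continuous_const.
exact: is_derive_continuous (is_derive_iterint_continuous _ IH t).
Qed.

Lemma is_derive_iterint (x : letter) (eta : word) (t : R) :
  is_derive (iterint u (x :: eta)) t (u x t * iterint u eta t).
Proof. exact/is_derive_iterint_continuous/iterint_continuous. Qed.

Lemma iterint0 (eta : word) : iterint u eta 0 = (eta == [::])%:R.
Proof. by case: eta => [|x eta] //=; rewrite RInt_point. Qed.

(** Integration by parts, iterated. *)
Lemma iterint_shuffle (eta xi : word) (t : R) :
  iterint u eta t * iterint u xi t =
  \sum_(w <- shuffle_word eta xi) iterint u w t.
Proof.
elim: eta xi t => [|x eta IHeta] xi.
  by case: xi => *; rewrite big_seq1 mul1r.
elim: xi => [|y xi IHxi] t; first by rewrite big_seq1 mulr1.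
move: t; apply: (ext_is_derive (h := fun t =>
  u x t * iterint u eta t * iterint u (y :: xi) t +
  iterint u (x :: eta) t * (u y t * iterint u xi t))) => [t|t|].
- by apply: is_deriveRM; apply: is_derive_iterint.
- apply: (is_deriveR_ext (f := fun t =>
    \sum_(w <- shuffle_word eta (y :: xi)) iterint u (x :: w) t +
    \sum_(w <- shuffle_word (x :: eta) xi) iterint u (y :: w) t)) => [s|].
    by rewrite [shuffle_word (_ :: _) (_ :: _)]/= big_cat !big_map.
  have -> : u x t * iterint u eta t * iterint u (y :: xi) t +
            iterint u (x :: eta) t * (u y t * iterint u xi t) =
            \sum_(w <- shuffle_word eta (y :: xi)) u x t * iterint u w t +
            \sum_(w <- shuffle_word (x :: eta) xi) u y t * iterint u w t.
    by rewrite -!mulr_sumr -IHeta -IHxi -mulrA [in X in _ + X]mulrCA.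
  by apply: is_deriveRD;
    [apply: (is_derive_sum (g := fun w t => u x t * iterint u w t)) => w _
    |apply: (is_derive_sum (g := fun w t => u y t * iterint u w t)) => w _];
    apply: is_derive_iterint.
rewrite !iterint0 mul0r big1_seq // => w /andP[_].
rewrite [shuffle_word (_ :: _) (_ :: _)]/= mem_cat iterint0.
by case/orP => /mapP[v _ ->].
Qed.

(** The coefficient of [r ^ n] in the product of [r ^ k] and the power series
    whose coefficients are the Fliess operators of the homogeneous components
    of [c]. The factor [r ^ k] absorbs the degrees lost when products are taken
    or letters removed; the bound on the length of the words is implied by the
    condition on their degree. *)
Definition fliess_gen (k : nat) (c : series) (t : R) (n : nat) : R :=
  \sum_(eta <- words_le n | (deg eta + k == n)%N) c eta * iterint u eta t.

Lemma deg_shuffle_word (eta xi w : word) :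
  w \in shuffle_word eta xi -> (deg w).+1 = (deg eta + deg xi)%N.
Proof.
have count_shuffle x : w \in shuffle_word eta xi ->
    count_mem x w = (count_mem x eta + count_mem x xi)%N.
  elim: eta xi w => [|y eta IHeta] xi w.
    by case: xi => [|z xi] /=; rewrite inE => /eqP->.
  elim: xi w => [|z xi IHxi] w; first by rewrite inE => /eqP->; rewrite addn0.
  rewrite /= mem_cat => /orP[] /mapP[v v_in ->] /=.
    by rewrite (IHeta _ _ v_in) /= addnA.
  by rewrite (IHxi _ v_in) /= addnCA.
move=> w_in; rewrite /deg !(count_shuffle _ w_in) mulnDr.
by rewrite !addn1 addSn addnS addnACA.
Qed.

Lemma size_lt_deg (eta : word) : (size eta < deg eta)%N.
Proof.
have -> : size eta = (count_mem x0 eta + count_mem x1 eta)%N.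
  rewrite -(count_predC (pred1 x0) eta); congr addn.
  by apply: eq_count => -[].
by rewrite /deg addn1 ltnS mul2n -addnn -addnA leq_add2l leq_addl.
Qed.

Lemma fliess_gen_widen k c t n N : (n <= N)%N ->
  fliess_gen k c t n =
  \sum_(eta <- words_le N | (deg eta + k == n)%N) c eta * iterint u eta t.
Proof.
move=> le_nN; rewrite /fliess_gen big_mkcond [RHS]big_mkcond /=; symmetry.
apply: sum_words_le_widen => // eta lt_eta; case: eqP => // eq_n.
have := ltn_trans lt_eta (size_lt_deg eta).
by rewrite -eq_n ltnNge leq_addr.
Qed.

Lemma sum_count_mem (r l : seq word) (F : word -> R) : uniq r ->
  \sum_(w <- r) (count_mem w l)%:R * F w = \sum_(w <- l | w \in r) F w.
Proof.
move=> uniq_r; elim: l => [|v l IH].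
  by rewrite big_nil big1 // => w _; rewrite mul0r.
rewrite big_cons -IH; have -> : \sum_(w <- r) (count_mem w (v :: l))%:R * F w =
  \sum_(w <- r) (if w == v then F v else 0) +
  \sum_(w <- r) (count_mem w l)%:R * F w.
  rewrite -big_split; apply: eq_bigr => w _ /=; rewrite natrD mulrDl eq_sym.
  by case: eqP => [->|]; rewrite ?mul1r ?mul0r.
rewrite -big_mkcond; case: ifP => [v_r|v_r].
  by rewrite -big_filter filter_pred1_uniq // big_seq1.
by rewrite big1_seq ?add0r // => w /andP[/eqP-> ]; rewrite v_r.
Qed.

(** Multiplication of the values of iterated integrals shuffles the words, and
    the degree minus one is additive under the shuffle product. *)
Lemma fliess_gen_shuffle (i j : nat) (a b : series) (t : R) (n : nat) :
  PS_mult (fliess_gen i a t) (fliess_gen j b t) n =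
  fliess_gen (i + j).+1 (shuffle a b) t n.
Proof.
pose E := iterint u ^~ t.
transitivity (\sum_(eta <- words_le n) \sum_(xi <- words_le n)
    if (deg eta + i + (deg xi + j) == n)%N
    then (a eta * E eta) * (b xi * E xi) else 0).
  rewrite /PS_mult sum_f_R0E big_mkord.
  transitivity (\sum_(k < n.+1) \sum_(eta <- words_le n)
     \sum_(xi <- words_le n)
       if (deg eta + i == k)%N && (deg xi + j == n - k)%N
       then (a eta * E eta) * (b xi * E xi) else 0).
    apply: eq_bigr => k _; rewrite RmultE.
    rewrite (@fliess_gen_widen _ _ _ k n) -1?ltnS //.
    rewrite (@fliess_gen_widen _ _ _ (n - k)%N n) ?leq_subr //.
    rewrite big_mkcond mulr_suml; apply: eq_bigr => eta _.
    case: eqP => _ /=; last by rewrite mul0r big1.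
    by rewrite mulr_sumr big_mkcond.
  rewrite exchange_big; apply: eq_bigr => eta _.
  rewrite exchange_big; apply: eq_bigr => xi _ /=.
  rewrite -big_mkcond; case: eqP => [eq_n|neq_n].
    have lt_eta : (deg eta + i < n.+1)%N by rewrite ltnS -eq_n leq_addr.
    rewrite (big_pred1 (Ordinal lt_eta)) // => k /=.
    rewrite -val_eqE /= eq_sym; case: eqP => //= ->.
    by rewrite -eq_n addKn eqxx.
  rewrite big_pred0 // => k; apply/negP => /andP[/eqP eq_k /eqP eq_nk].
  by apply: neq_n; rewrite eq_k eq_nk subnKC // -ltnS.
pose r := [seq w <- words_le n | (deg w + (i + j).+1 == n)%N].
rewrite /fliess_gen -[RHS]big_filter -/r.
transitivity (\sum_(eta <- words_le n) \sum_(xi <- words_le n)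
   a eta * b xi * \sum_(w <- shuffle_word eta xi | w \in r) E w).
  apply: eq_bigr => eta _; apply: eq_bigr => xi _.
  have in_r w : w \in shuffle_word eta xi ->
      (w \in r) = (deg eta + i + (deg xi + j) == n)%N.
    move=> /deg_shuffle_word deg_w; rewrite mem_filter mem_words_le.
    rewrite addnS -addSn deg_w addnACA andb_idr // => /eqP <-.
    rewrite addnACA -deg_w addSn ltnW // ltnS.
    by rewrite (leq_trans (ltnW (size_lt_deg w))) ?leq_addr.
  rewrite big_seq_cond; case: eqP => [eq_n|neq_n]; last first.
    rewrite big_pred0 ?mulr0 // => w; apply/negP => /andP[/in_r -> /eqP].
    exact: neq_n.
  rewrite mulrACA (iterint_shuffle eta xi) [in LHS]big_seq; congr (_ * _).
  by apply: eq_bigl => w; rewrite andb_idr // => /in_r->; apply/eqP.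
transitivity (\sum_(eta <- words_le n) \sum_(xi <- words_le n)
    \sum_(w <- r)
      a eta * b xi * (count_mem w (shuffle_word eta xi))%:R * E w).
  apply: eq_bigr => eta _; apply: eq_bigr => xi _.
  rewrite -sum_count_mem ?filter_uniq ?uniq_words_le // mulr_sumr.
  by apply: eq_bigr => w _; rewrite mulrA.
transitivity (\sum_(w <- r) \sum_(eta <- words_le n) \sum_(xi <- words_le n)
    a eta * b xi * (count_mem w (shuffle_word eta xi))%:R * E w).
  by rewrite [RHS]exchange_big; apply: eq_bigr => eta _; rewrite exchange_big.
apply: eq_big_seq => w; rewrite mem_filter mem_words_le => /andP[_ le_w].
rewrite (shuffle_widen _ _ le_w) mulr_suml.
by apply: eq_bigr => eta _; rewrite mulr_suml.
Qed.

(** Removing the first letter lowers the degree by two for [x0] and by one for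
    [x1]. *)
Lemma is_derive_fliess_gen (c : series) (t : R) (n : nat) :
  is_derive (fun s => fliess_gen 0 c s n) t
    (u x0 t * fliess_gen 2 (lderiv x0 c) t n +
     u x1 t * fliess_gen 1 (lderiv x1 c) t n).
Proof.
pose F x s (eta : word) : R :=
  if (deg (x :: eta) == n)%N then c (x :: eta) * iterint u (x :: eta) s else 0.
pose dF x s (eta : word) : R :=
  u x s * if (deg (x :: eta) == n)%N then c (x :: eta) * iterint u eta s else 0.
have dFE x s eta : is_derive (F x ^~ eta) s (dF x s eta).
  rewrite /F /dF; case: ifP => _; last first.
    by rewrite mulr0; apply: is_deriveR_const.
  by rewrite mulrCA; apply: is_deriveRZ; apply: is_derive_iterint.
have dsum x : is_derive (fun s => \sum_(eta <- words_le n) F x s eta) t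
    (\sum_(eta <- words_le n) dF x t eta).
  exact: (is_derive_sum (f := fun eta s => F x s eta)
                        (g := fun eta s => dF x s eta)).
pose k : R := if (deg [::] == n)%N then c [::] else 0.
have expand s : k + (\sum_(eta <- words_le n) F x1 s eta +
      \sum_(eta <- words_le n) F x0 s eta) = fliess_gen 0 c s n.
  rewrite [RHS](fliess_gen_widen _ _ _ (leqnSn n)) [RHS]big_mkcond.
  rewrite [RHS]sum_words_leS big_bool addn0 mulr1.
  by congr (_ + (_ + _)); apply: eq_bigr => eta _; rewrite addn0.
apply: (is_deriveR_ext expand).
have -> : u x0 t * fliess_gen 2 (lderiv x0 c) t n +
          u x1 t * fliess_gen 1 (lderiv x1 c) t n =
          0 + (\sum_(eta <- words_le n) dF x1 t eta +
               \sum_(eta <- words_le n) dF x0 t eta).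
  have sum_dF x j : (forall eta, deg (x :: eta) = deg eta + j)%N ->
      u x t * fliess_gen j (lderiv x c) t n =
      \sum_(eta <- words_le n) dF x t eta.
    move=> deg_x; rewrite /fliess_gen big_mkcond mulr_sumr.
    by apply: eq_bigr => eta _; rewrite /dF deg_x.
  rewrite add0r addrC (sum_dF x0 2%N) ?(sum_dF x1 1%N) // => eta.
    by rewrite /deg /= add0n addnCA add1n addnAC !addn1.
  by rewrite /deg /= add0n mulnDr -!addnA addnC -!addnA.
apply: is_deriveRD; first exact: is_deriveR_const.
by apply: is_deriveRD; apply: dsum.
Qed.

Lemma fliess_gen_const (k : nat) (c : series) (t : R) :
  fliess_gen k c t 0 = 0.
Proof. by rewrite /fliess_gen big_mkcond sum_words_le0. Qed.

Lemma fliess_gen0 (c : series) (n : nat) :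
  fliess_gen 0 c 0 n = if n == 1%N then c [::] else 0.
Proof.
rewrite (fliess_gen_widen _ _ _ (leqnSn n)) big_mkcond sum_words_leS.
rewrite [X in _ + X]big1 => [|x _]; last first.
  by rewrite big1 // => eta _; rewrite iterint0 mulr0 if_same.
by rewrite addr0 /= addn0 mulr1 eq_sym.
Qed.

End ContinuousInput.

(** * The Abel equation *)

Lemma is_derive_abel (u : letter -> R -> R) (e : series) (t : R) (n : nat) :
    (forall x s, continuous (u x) s) -> abel_system e ->
  let z := fliess_gen u 0 e t in
  is_derive (fun s => fliess_gen u 0 e s n) t
    (u x0 t * PS_mult z (PS_mult z z) n + u x1 t * PS_mult z z n).
Proof.
move=> u_cont [_ e_x1 e_x0] z.
have z2 : PS_mult z z = fliess_gen u 1 (shuffle e e) t.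
  by apply: functional_extensionality => m; apply: fliess_gen_shuffle.
rewrite z2 (fliess_gen_shuffle u_cont 0 1) -e_x0 -e_x1.
exact: is_derive_fliess_gen.
Qed.

Lemma hpart_fliess (u : letter -> R -> R) (c : series) (t : R) (n : nat) :
  fliess (hpart n c) u t = fliess_gen u 0 c t n.
Proof.
rewrite -[LHS]/(mmap idfun (iterint u ^~ t) (hpart n c)) raddf_sum /=.
rewrite /words_deg big_filter.
apply: eq_big => [eta|eta _]; first by rewrite addn0.
by rewrite mmapU.
Qed.

(** Without constant terms, the two end terms of the convolution, the only ones
    that involve the order [n], vanish. *)
Lemma PS_mult_eq_below (a a' b b' : nat -> R) (n : nat) :
    a 0%N = 0 -> a' 0%N = 0 -> b 0%N = 0 -> b' 0%N = 0 ->
    (forall k, (k < n)%N -> a k = a' k) ->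
    (forall k, (k < n)%N -> b k = b' k) ->
  PS_mult a b n = PS_mult a' b' n.
Proof.
move=> a0 a'0 b0 b'0 eq_a eq_b; rewrite /PS_mult !sum_f_R0E.
apply: eq_big_nat => k /andP[_]; rewrite ltnS => le_k; rewrite !RmultE.
case: k le_k => [|k] le_k; first by rewrite a0 a'0 !mul0r.
move: le_k; rewrite leq_eqVlt => /orP[/eqP->|lt_k].
  by rewrite minusE subnn b0 b'0 !mulr0.
by rewrite eq_a // minusE eq_b // ltn_subrL (leq_ltn_trans _ lt_k).
Qed.

(** This is what makes the Abel equation a recursion on the order in [r]. *)
Lemma abel_field_eq_below (z w : nat -> R) (n : nat) :
    z 0%N = 0 -> w 0%N = 0 -> (forall k, (k < n)%N -> z k = w k) ->
  PS_mult z z n = PS_mult w w n /\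
  PS_mult z (PS_mult z z) n = PS_mult w (PS_mult w w) n.
Proof.
move=> z0 w0 eq_zw.
have sq0 (y : nat -> R) : y 0%N = 0 -> PS_mult y y 0 = 0.
  by move=> y0; rewrite /PS_mult /= y0 RmultE mul0r.
have sq k : (k <= n)%N -> PS_mult z z k = PS_mult w w k.
  move=> le_k; apply: PS_mult_eq_below => // j lt_j;
    exact/eq_zw/(leq_trans lt_j le_k).
split; first exact: sq.
by apply: PS_mult_eq_below => //; rewrite ?sq0 // => k lt_k; apply/sq/ltnW.
Qed.

(** Retraction of the line onto the segment with endpoints [0] and [t]. It
    turns functions continuous relatively to an interval into functions
    continuous everywhere, to which the one-dimensional calculus applies. *)
Definition clamp (t s : R) : R := Rmax (Rmin 0 t) (Rmin (Rmax 0 t) s).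

Definition between0 (t s : R) : Prop := Rle (Rmin 0 t) s /\ Rle s (Rmax 0 t).

Lemma clamp_between0 (t s : R) : between0 t (clamp t s).
Proof.
split; first exact: Rmax_l.
apply: Rmax_lub; last exact: Rmin_l.
exact: Rle_trans (Rmin_l 0 t) (Rmax_l 0 t).
Qed.

Lemma clamp_id (t s : R) : between0 t s -> clamp t s = s.
Proof.
move=> [le_s ge_s]; rewrite /clamp (Rmin_right (Rmax 0 t)) //.
exact: Rmax_right.
Qed.

Lemma between0_trans (t s x : R) :
  between0 t s -> between0 s x -> between0 t x.
Proof.
move=> [ge_s le_s] [ge_x le_x]; split.
  by apply: Rle_trans ge_x; apply: Rmin_glb => //; apply: Rmin_l.
by apply: (Rle_trans _ _ _ le_x); apply: Rmax_lub => //; apply: Rmax_l.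
Qed.

Lemma continuous_clamp (t s : R) : continuous (clamp t) s.
Proof.
have lip y : Rle (Rabs (Rminus (clamp t y) (clamp t s))) (Rabs (Rminus y s)).
  have lip_max a b b' :
      Rle (Rabs (Rminus (Rmax a b) (Rmax a b'))) (Rabs (Rminus b b')).
    by rewrite /Rmax; do !case: Rle_dec => ?;
       rewrite /Rabs; do !case: Rcase_abs => ?; lra.
  have lip_min a b b' :
      Rle (Rabs (Rminus (Rmin a b) (Rmin a b'))) (Rabs (Rminus b b')).
    by rewrite /Rmin; do !case: Rle_dec => ?;
       rewrite /Rabs; do !case: Rcase_abs => ?; lra.
  exact: Rle_trans (lip_max _ _ _) (lip_min _ _ _).
apply: (proj2 (filterlim_locally _ _)) => eps.
by exists eps => y; apply: Rle_lt_trans (lip y).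
Qed.

Section Interval.

Variable I : R -> Prop.
Hypotheses (I_interval : is_interval I) (I0 : I 0).

Lemma interval_between0 (t s : R) : I t -> between0 t s -> I s.
Proof.
move=> It [le_s ge_s]; have [/RleP t_ge0|/Rlt_le/RleP t_le0] := Rle_lt_dec 0 t.
  apply: (I_interval I0 It); apply/andP; split; apply/RleP.
    by move: le_s; rewrite Rmin_left //; apply/RleP.
  by move: ge_s; rewrite Rmax_right //; apply/RleP.
apply: (I_interval It I0); apply/andP; split; apply/RleP.
  by move: le_s; rewrite Rmin_right //; apply/RleP.
by move: ge_s; rewrite Rmax_left //; apply/RleP.
Qed.

Lemma analytic_continuous_clamp (f : R -> R) (t s : R) :
  analytic_on I f -> I t -> continuous (fun y => f (clamp t y)) s.
Proof.
move=> f_an It; set p := clamp t s.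
have Iclamp y : I (clamp t y).
  exact: interval_between0 It (clamp_between0 t y).
have [a [a_gt0 f_a]] := f_an p (Iclamp s).
have cont_a : continuous (fun y => PSeries a (Rminus (clamp t y) p)) s.
  apply: (@continuous_comp _ _ _ (fun y => Rminus (clamp t y) p) (PSeries a)).
    apply: (@continuous_minus _ _ _ (clamp t) (fun _ => p)).
      exact: continuous_clamp.
    exact: continuous_const.
  apply/continuity_pt_filterlim/PSeries_continuity.
  by rewrite /p Rminus_diag Rabs_R0.
apply: continuous_ext_loc cont_a.
have near_a := @continuous_clamp t s _ f_a.
move: near_a; apply: (@filter_imp _ (locally s)) => y f_y.
by rewrite f_y.
Qed.

Lemma is_derive_clamp (f : R -> R) (t x l : R) :
    I t -> Rlt (Rmin 0 t) x -> Rlt x (Rmax 0 t) -> is_derive_in I f x l ->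
  is_derive (fun s => f (clamp t s)) x l.
Proof.
move=> It lt_x gt_x [lin_l dom_l].
have near_x : locally x (between0 t).
  have : locally x (fun y => Rlt (Rmin 0 t) y /\ Rlt y (Rmax 0 t)).
    by apply: (@filter_and _ (locally x)); [apply: open_gt | apply: open_lt].
  by apply: (@filter_imp _ (locally x)) => y [/Rlt_le le_y /Rlt_le ge_y].
have near_clamp : locally x (fun y => f y = f (clamp t y)).
  move: near_x; apply: (@filter_imp _ (locally x)) => y y_t.
  by rewrite clamp_id.
apply: is_derive_ext_loc near_clamp _; split=> [|y lim_y eps].
  exact: is_linear_scal_l.
have near_y : is_filter_lim (within I (locally x)) y.
  by move=> P /lim_y; apply: (@filter_imp _ (locally x)) => z.
pose proof (filter_and _ _ near_x (dom_l y near_y eps)) as near_z.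
move: near_z; apply: (@filter_imp _ (locally x)) => z.
by move=> [/(interval_between0 It) Iz]; exact.
Qed.

End Interval.

(** Both sides vanish at [0], except for the coefficient of order one, and
    have the same derivative as soon as they agree in lower orders. *)
Lemma formal_solution_fliess (I : R -> Prop) (alpha beta : R -> R)
    (a : nat -> R -> R) (e : series) (n : nat) (t : R) :
    is_interval I -> I 0 -> analytic_on I alpha -> analytic_on I beta ->
    formal_solution I alpha beta a -> abel_system e -> (1 <= n)%N -> I t ->
  a n t = fliess (hpart n e) (input alpha beta) t.
Proof.
move=> I_int I0 an_alpha an_beta [an_a a1_0 an_0 deriv_a] sys_e n_gt0 It.
pose u := input alpha beta; pose v x s := u x (clamp t s).
have v_cont x s : continuous (v x) s.
  by case: x; apply: (analytic_continuous_clamp I_int I0).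
have iterint_uv eta s : between0 t s -> iterint u eta s = iterint v eta s.
  elim: eta s => [|x eta IH] s s_t //=.
  apply: RInt_ext => y [lt_y gt_y].
  have y_t : between0 t y.
    by apply: (between0_trans s_t); split; apply: Rlt_le.
  by rewrite /v clamp_id // IH.
have t_t : between0 t t by split; [exact: Rmin_r | exact: Rmax_r].
rewrite hpart_fliess; have -> : fliess_gen u 0 e t n = fliess_gen v 0 e t n.
  by apply: eq_bigr => eta _; rewrite iterint_uv.
suff eq_n s : between0 t s -> a n s = fliess_gen v 0 e s n by exact: eq_n.
elim/ltn_ind: n n_gt0 s => n IH n_gt0 s s_t.
rewrite -{1}(clamp_id s_t).
pose field x := v x0 x * PS_mult (fliess_gen v 0 e x)
    (PS_mult (fliess_gen v 0 e x) (fliess_gen v 0 e x)) n +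
  v x1 x * PS_mult (fliess_gen v 0 e x) (fliess_gen v 0 e x) n.
have d_fliess x : is_derive (fun y => fliess_gen v 0 e y n) x (field x).
  exact: is_derive_abel.
apply: (@eq_is_derive_segment (fun y => a n (clamp t y))
  (fun y => fliess_gen v 0 e y n) field).
- move=> x lt_x gt_x; split; last exact: d_fliess.
  have x_t : between0 t x.
    by apply: (between0_trans s_t); split; apply: Rlt_le.
  have Ix : I x by apply: interval_between0 It x_t.
  have eq_below k : (k < n)%N -> zcoef a x k = fliess_gen v 0 e x k.
    case: k => [|k] lt_k; first by rewrite fliess_gen_const.
    exact: IH.
  have [sq cube] := abel_field_eq_below (erefl : zcoef a x 0%N = 0)
    (fliess_gen_const v 0 e x) eq_below.
  rewrite /field -sq -cube /v !clamp_id //.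
  apply: (is_derive_clamp I_int I0 It) (deriv_a n x n_gt0 Ix).
    by apply: Rle_lt_trans lt_x; apply: Rmin_glb; [exact: Rmin_l | case: s_t].
  apply: (Rlt_le_trans _ _ _ gt_x).
  by apply: Rmax_lub; [exact: Rmax_l | case: s_t].
- by move=> x; apply: (analytic_continuous_clamp I_int I0) => //; apply: an_a.
- by move=> x; apply: is_derive_continuous (d_fliess x).
rewrite clamp_id; last by split; [exact: Rmin_l | exact: Rmax_l].
rewrite fliess_gen0; have [e_nil _ _] := sys_e.
case: eqP n_gt0 => [-> | /eqP neq1 n_gt0]; first by rewrite e_nil.
by rewrite an_0 // ltn_neqAle eq_sym neq1.
Qed.

Theorem theorem7 (n : nat) (n_ge1 : (1 <= n)%N) :
  (forall (Delta : {lrmorphism Halg -> Halg2}) (S : {linear Halg -> Halg}),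
     is_coproduct Delta -> is_antipode Delta S ->
     abel_poly n =
     \sum_(eta <- words_deg n)
       << heval (\- fact_series) (S (coordf eta)) *g eta >>) /\
  (forall (I : R -> Prop) (alpha beta : R -> R) (a : nat -> R -> R),
     is_interval I -> I 0 ->
     analytic_on I alpha -> analytic_on I beta ->
     formal_solution I alpha beta a ->
     forall t : R, I t -> a n t = fliess (abel_poly n) (input alpha beta) t).
Proof.
split=> [Delta S coprod antipode | I alpha beta a I_int I0 an_alpha an_beta].
  have [right_inv _] := is_fginv_fginv.
  apply: eq_bigr => eta _.
  by rewrite (antipode_eval eta coprod antipode right_inv).
move=> sol t It.
exact: formal_solution_fliess sol fginv_abel_system n_ge1 It.
Qed.
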